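(* Let $m\ge 1$ be an integer. For any $\lambda>0$ and any $f\in C^2_b(\mathbb{R}^m)$, $$ \sup_{x\in\mathbb{R}^m}\ \lambda^{1/2}\,|D R(1,M_m)f(x)|_{\mathbb{R}^m}\ \le\ \frac{\pi}{\sqrt2}\ \sup_{x\in\mathbb{R}^m}|f(x)|, $$ where $R(1,M_m)f$ is the function $$ R(1,M_m)f(x)=\int_0^\infty e^{-t}(S^m_tf)(x)\,dt,\quad S^m_tf(x)=\int_{\mathbb{R}^m} f\big(e^{-\lambda t}x+\sqrt{1-e^{-2\lambda t}}\,y\big)\,N\big(0,\tfrac{1}{2\lambda}I_m\big)(dy),\quad x\in\mathbb{R}^m,\ t\ge0. $$
   Context: $C^2_b(\mathbb{R}^m)$ is the space of bounded $C^2$ functions $f:\mathbb{R}^m\to\mathbb{R}$ with all first and second partial derivatives bounded. $D$ denotes the gradient, $|\cdot|_{\mathbb{R}^m}$ the Euclidean norm, $I_m$ the $m\times m$ identity matrix, and $N(0,Q)$ the centered Gaussian measure on $\mathbb{R}^m$ with covariance matrix $Q$. $M_m$ is the Ornstein-Uhlenbeck operator $M_m=\frac12\triangle_m-\lambda\langle x,D\rangle$ on $\mathbb{R}^m$; the function $v=R(1,M_m)f\in C^2_b(\mathbb{R}^m)$ is the bounded classical solution of $v(x)-\big(\frac12\triangle_m v(x)-\lambda\langle x,Dv(x)\rangle\big)=f(x)$, $x\in\mathbb{R}^m$. *)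

(* Defs.v *)
From HB Require Import structures.
From mathcomp Require Import all_boot all_order all_algebra.
From mathcomp Require Import all_classical all_reals all_analysis.
From mathcomp Require Import measurable_realfun.
Import numFieldNormedType.Exports.

Set Implicit Arguments.
Unset Strict Implicit.
Unset Printing Implicit Defensive.
Import Order.TTheory GRing.Theory Num.Def Num.Theory.

Local Open Scope classical_set_scope.
Local Open Scope ring_scope.

(* Points of R^m are row vectors 'rV[R]_m.  The library norm on 'rV[R]_m is the
   sup norm: it is used only through the topology it induces; [enorm] below is
   the Euclidean norm. *)

Section Euclidean.
Context {R : realType} {m : nat}.

Definition enorm (x : 'rV[R]_m) : R := sqrtr (\sum_i x 0 i ^+ 2).

Definition partial (i : 'I_m) (g : 'rV[R]_m -> R) : 'rV[R]_m -> R :=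
  fun x => 'D_(delta_mx 0 i) g x.

Definition grad (g : 'rV[R]_m -> R) (x : 'rV[R]_m) : 'rV[R]_m :=
  \row_i partial i g x.

Definition C1 (g : 'rV[R]_m -> R) : Prop :=
  [/\ continuous g,
      forall i x, derivable g x (delta_mx 0 i) &
      forall i, continuous (partial i g)].

Definition C2b (f : 'rV[R]_m -> R) : Prop :=
  [/\ C1 f,
      forall i, C1 (partial i f),
      bounded_fun f,
      forall i, bounded_fun (partial i f) &
      forall i j, bounded_fun (partial j (partial i f))].

End Euclidean.

(* The sigma-algebra on 'rV[R]_m generated by the coordinates, which is the
   Borel sigma-algebra. *)
Section measurable_rV.
Context {R : realType} (m : nat).

Let coord (i : 'I_m) (x : 'rV[R]_m) : measurableTypeR R := x 0 i.

Let rV_set0 : g_sigma_preimage coord set0.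
Proof. exact: sigma_algebra0. Qed.

Let rV_setC A : g_sigma_preimage coord A -> g_sigma_preimage coord (~` A).
Proof. exact: sigma_algebraC. Qed.

Let rV_bigcup (F : (set 'rV[R]_m)^nat) :
  (forall i, g_sigma_preimage coord (F i)) ->
  g_sigma_preimage coord (\bigcup_i (F i)).
Proof. exact: sigma_algebra_bigcup. Qed.

HB.instance Definition _ :=
  @isMeasurable.Build (measure_tuple_display default_measure_display)
    'rV[R]_m (g_sigma_preimage coord) rV_set0 rV_setC rV_bigcup.

Lemma measurable_coord (i : 'I_m) :
  measurable_fun [set: 'rV[R]_m] (fun x => x 0 i : measurableTypeR R).
Proof.
move=> _ Y mY; rewrite setTI; apply: sub_sigma_algebra => /=.
rewrite -bigcup_seq/=; exists i => /=; first by rewrite mem_index_enum.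
by exists Y => //; rewrite setTI.
Qed.

Lemma measurable_fun_coordP d (T : measurableType d) (f : T -> 'rV[R]_m) :
  (forall i, measurable_fun setT (fun t => f t 0 i : measurableTypeR R)) ->
  measurable_fun setT f.
Proof.
move=> mf; apply: (@measurability _ _ _ _ setT f
  (\big[setU/set0]_(i < m) preimage_set_system setT (coord i) measurable)) => //.
move=> _ [C + <-]; rewrite -bigcup_seq => -[i _ [B mB <-]].
by rewrite !setTI; have := mf i measurableT B mB; rewrite setTI.
Qed.

End measurable_rV.

Section Gaussian.
Context {R : realType}.

Definition cons_rV m (p : measurableTypeR R * 'rV[R]_m) : 'rV[R]_m.+1 :=
  row_mx (p.1%:M : 'rV[R]_1) p.2 : 'rV[R]_(1 + m).

Lemma measurable_cons_rV m : measurable_fun setT (@cons_rV m).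
Proof.
apply: measurable_fun_coordP => i; rewrite /cons_rV.
case: (@split_ordP 1 m i) => j ->.
  rewrite (_ : (fun _ => _) = fst) //; apply/funext => p.
  by rewrite (@row_mxEl _ 1 1 m) mxE (ord1 j) eqxx.
rewrite (_ : (fun _ => _) = (fun x : 'rV[R]_m => x 0 j) \o snd).
  exact: measurableT_comp (measurable_coord _) _.
by apply/funext => p; rewrite (@row_mxEr _ 1 1 m).
Qed.

HB.instance Definition _ m :=
  isMeasurableFun.Build _ _ _ _ (@cons_rV m) (@measurable_cons_rV m).

(* N(0, I_m), the m-fold product of N(0, 1). *)
Fixpoint std_gaussian m : probability 'rV[R]_m R :=
  match m with
  | 0 => \d_(0 : 'rV[R]_0)
  | m'.+1 => distribution (normal_prob 0 1 \x std_gaussian m')%E (@cons_rV m')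
  end.

Definition psd m (A : 'M[R]_m) : Prop :=
  A^T = A /\ forall x : 'rV[R]_m, 0 <= (x *m A *m x^T) 0 0.

(* The positive semidefinite square root of Q (0 if Q has none, i.e. if Q is
   not positive semidefinite). *)
Definition psd_sqrt m (Q : 'M[R]_m) : 'M[R]_m :=
  xget 0 [set A | psd A /\ A *m A = Q].

Definition rmul m (A : 'M[R]_m) (y : 'rV[R]_m) : 'rV[R]_m := y *m A.

Lemma measurable_rmul m (A : 'M[R]_m) : measurable_fun setT (rmul A).
Proof.
apply: measurable_fun_coordP => i.
rewrite (_ : (fun _ => _) =
  fun y : 'rV[R]_m => \sum_(j < m) (y 0 j * A j i)); last first.
  by apply/funext => y; rewrite mxE.
apply: measurable_sum => j; apply: measurable_funM => //.
exact: measurable_coord.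
Qed.

HB.instance Definition _ m (A : 'M[R]_m) :=
  isMeasurableFun.Build _ _ _ _ (rmul A) (measurable_rmul A).

(* N(0, Q) for a covariance matrix Q: the law of Z Q^(1/2) with Z ~ N(0, I_m). *)
Definition gaussian m (Q : 'M[R]_m) : probability 'rV[R]_m R :=
  distribution (std_gaussian m) (rmul (psd_sqrt Q)).

Lemma mulmx_tr_eq0 m (x : 'rV[R]_m) : (x *m x^T) 0 0 <= 0 -> x = 0.
Proof.
rewrite mxE => x_le0; apply/rowP => i; rewrite [RHS]mxE; apply/eqP.
rewrite -sqrf_eq0.
have sqx j : x 0 j * x^T j 0 = x 0 j ^+ 2 by rewrite mxE expr2.
move: x_le0; under eq_bigr do rewrite sqx.
move=> x_le0; have /eqP : \sum_j x 0 j ^+ 2 = 0.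
  by apply/eqP; rewrite eq_le x_le0 sumr_ge0// => j _; exact: sqr_ge0.
by rewrite psumr_eq0 => [/allP/(_ i)|j _]; rewrite ?mem_index_enum ?sqr_ge0//; exact.
Qed.

Lemma psd_sqrt_scalar m (q : R) : 0 <= q ->
  psd_sqrt (q%:M : 'M[R]_m) = (sqrtr q)%:M.
Proof.
move=> q0; set s := sqrtr q.
have s0 : 0 <= s by exact: sqrtr_ge0.
have ss : s * s = q by rewrite -expr2 sqr_sqrtr.
have xx0 (x : 'rV[R]_m) : 0 <= (x *m x^T) 0 0.
  by rewrite mxE sumr_ge0// => i _; rewrite mxE -expr2 sqr_ge0.
apply: xget_unique => [|A [[Asym Apsd] AA]].
  split; last by rewrite -scalar_mxM ss.
  split=> [|x]; first by rewrite tr_scalar_mx.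
  by rewrite mul_mx_scalar -scalemxAl mxE mulr_ge0.
have BA : (A - s%:M) *m A = - s *: (A - s%:M).
  rewrite mulmxBl AA mul_scalar_mx scalerBr scale_scalar_mx -ss.
  by rewrite !scaleNr mulNr raddfN /= opprK addrC.
apply/subr0_eq/row_matrixP => i; rewrite row0; set b := row i _.
have bA : b *m A = - s *: b by rewrite /b -row_mul BA linearZ.
apply: mulmx_tr_eq0.
have [s_eq0|s_neq0] := eqVneq s 0.
  have -> : b = row i A by rewrite /b s_eq0 raddf0 subr0.
  have := congr1 (fun M : 'M[R]_m => M i i) AA.
  rewrite [RHS]mxE eqxx -ss s_eq0 mulr0 => AAii.
  rewrite -[leRHS]AAii !mxE le_eqVlt; apply/orP; left; apply/eqP.
  by apply: eq_bigr => j _; rewrite -{2}Asym !mxE.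
have := Apsd b; rewrite bA -scalemxAl mxE mulNr oppr_ge0 pmulr_rle0//.
by rewrite lt_neqAle eq_sym s_neq0.
Qed.

End Gaussian.

Section OrnsteinUhlenbeck.
Context {R : realType} {m : nat} (lam : R).

Definition OU_semigroup (t : R) (f : 'rV[R]_m -> R) (x : 'rV[R]_m) : R :=
  \int[gaussian ((2 * lam)^-1)%:M]_y
    f (expR (- (lam * t)) *: x + sqrtr (1 - expR (- (2 * lam * t))) *: y).

Definition OU_resolvent1 (f : 'rV[R]_m -> R) (x : 'rV[R]_m) : R :=
  \int[lebesgue_measure]_(t in `[0, +oo[) (expR (- t) * OU_semigroup t f x).

End OrnsteinUhlenbeck.

(* Main.v *)
(* By Gaussian integration by parts, for a unit vector [h],
   [<D S_t f(x), h> = e^(- lam t) / sigma_t * E (f(e^(- lam t) x + sigma_t Y) <h, Y>)]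
   where [Y ~ N(0, I)] and [sigma_t^2 = (1 - e^(- 2 lam t)) / (2 lam)]. As
   [E |<h, Y>| <= 1], the norm of [D S_t f] is at most
   [sqrt (2 lam) e^(- lam t) / sqrt (1 - e^(- 2 lam t)) * sup |f|], and
   the integral of [e^(- lam t) / sqrt (1 - e^(- 2 lam t))] over [t > 0] is
   [pi / (2 lam)], through the primitive [- asin (e^(- lam t)) / lam].
   Since [f] has bounded second derivatives, its first-order Taylor remainder is
   uniformly quadratic; integrating it shows that the resolvent is
   differentiable with gradient [int_0^oo e^(- t) e^(- lam t) S_t (D f) dt]. *)

Require Import Defs.
From HB Require Import structures.
From mathcomp Require Import all_boot all_order all_algebra.
From mathcomp Require Import all_classical all_reals all_analysis.
From mathcomp Require Import measurable_realfun ring lra.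
Import numFieldNormedType.Exports.
Import Order.TTheory GRing.Theory Num.Def Num.Theory.

Set Implicit Arguments.
Unset Strict Implicit.
Unset Printing Implicit Defensive.

Local Open Scope classical_set_scope.
Local Open Scope ring_scope.

(** The bounds on the derivatives of [f] enter only qualitatively: they justify the remainder
    estimate and the integrals. The final constant may involve [sup |f|] alone, so two bounds run
    side by side, [C] for [f] and its derivatives, [M] for [f]. The kernel that multiplies [M] is
    unbounded near [t = 0]; there the bound by [C] takes over, on an initial interval that can be
    made arbitrarily short. The factor [e^(- t)] is simply bounded by 1: the kernel decays by
    itself, and its integral together with [sqrt (2 lam)] produces the power of [lam] in the claim.
    The direction [h] is not normalised: it is taken to be the gradient [G] itself, which gives
    [<G, G> <= c |G|], hence [|G| <= c]. Remainders are measured in the sup norm; the Euclidean norm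
    enters through the Gaussian weight [<h, y>], whose second moment is at most [|h|^2]. *)

Section general_integrals.
Context {R : realType}.

Lemma bounded_integrable_prob d (T : measurableType d) (P : probability T R)
    (f : T -> R) (C : R) (U : set T) : measurable U ->
  measurable_fun setT f -> (forall x, U x -> `|f x| <= C) ->
  P.-integrable U (EFin \o f).
Proof.
move=> mU mf fC; apply: measurable_bounded_integrable => //.
- by rewrite (le_lt_trans (probability_le1 P mU))// ltry.
- exact: measurable_funTS.
- exists C; split; first exact: num_real.
  by move=> y Cy x Ux /=; rewrite (le_trans (fC _ Ux))// ltW.
Qed.

Lemma bounded_mul_integrable d (T : measurableType d) (P : {measure set T -> \bar R})
    (g h : T -> R) (C : R) :
  measurable_fun setT g -> (forall x, `|g x| <= C) ->
  P.-integrable setT (EFin \o h) -> P.-integrable setT (fun x => (g x * h x)%:E).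
Proof.
move=> mg gC ih.
have /measurable_EFinP mh := measurable_int _ ih.
apply: (@le_integrable _ _ _ _ _ _ _ (fun x => (C%:E * (h x)%:E)%E)) => //.
- by apply/measurable_EFinP; exact: measurable_funM.
- move=> x _; rewrite /= lee_fin !normrM ler_wpM2r// (le_trans (gC x))// ler_norm//.
- exact: integrableZl.
Qed.

Lemma integral_prob_cst d (T : measurableType d) (P : probability T R) (r : R) :
  (\int[P]_x r%:E = r%:E)%E.
Proof.
rewrite integral_cst// (_ : _ [set: T] = 1%E) ?mule1//.
exact: (@probability_setT _ _ _ P).
Qed.

Lemma le_normr_Rintegral_prob d (T : measurableType d) (P : probability T R)
    (g : T -> R) (C : R) :
  P.-integrable setT (EFin \o g) -> (forall y, `|g y| <= C) ->
  `|\int[P]_y g y| <= C.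
Proof.
move=> ig gC; apply: (le_trans (le_normr_Rintegral _ ig)) => //.
apply: (@le_trans _ _ (\int[P]_y C)).
  apply: le_Rintegral => //; first exact: integrable_norm ig.
  exact: finite_measure_integrable_cst.
by rewrite /Rintegral integral_prob_cst.
Qed.

(** From [|f| <= 1 + f^2], the constant 1 being integrable for a probability. *)
Lemma integrable_of_sqr d (T : measurableType d) (P : probability T R) (f : T -> R) :
  measurable_fun setT f -> P.-integrable setT (fun x => (f x * f x)%:E) ->
  P.-integrable setT (EFin \o f).
Proof.
move=> mf fi.
apply: (@le_integrable _ _ _ _ _ _ _ (fun x => (1 + f x * f x)%:E)) => //.
- exact/measurable_EFinP.
- move=> x _; rewrite /= lee_fin [leRHS]ger0_norm; last first.
    by rewrite addr_ge0// -expr2 sqr_ge0.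
  rewrite (_ : f x * f x = `|f x| * `|f x|); last by rewrite -!expr2 real_normK ?num_real.
  nra.
- rewrite (_ : (fun _ => _) = cst 1%E \+ (fun x => (f x * f x)%:E))//.
  apply: integrableD => //.
  exact: finite_measure_integrable_cst.
Qed.

Lemma Rintegral_sumZ d (T : measurableType d) (mu : {measure set T -> \bar R}) (D : set T)
    (I : finType) (c : I -> R) (G : I -> T -> R) :
  measurable D -> (forall i, mu.-integrable D (EFin \o G i)) ->
  mu.-integrable D (EFin \o (fun t => \sum_i c i * G i t)) /\
  \int[mu]_(t in D) (\sum_i c i * G i t) = \sum_i c i * \int[mu]_(t in D) G i t.
Proof.
move=> mD iG.
have iZ i : mu.-integrable D (EFin \o (fun t => c i * G i t)).
  exact: (@integrableZl _ _ _ mu _ mD (c i) _ (iG i)).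
(* The induction needs an arbitrary list in place of the enumeration of [I], and additivity of the
   integral needs the integrability of the tail, so both claims are carried together. *)
suff H (s : seq I) : mu.-integrable D (EFin \o (fun t => \sum_(i <- s) c i * G i t)) /\
  \int[mu]_(t in D) (\sum_(i <- s) c i * G i t) = \sum_(i <- s) c i * \int[mu]_(t in D) G i t.
  exact: H.
elim: s => [|i s [si IHs]].
  split; first by under eq_fun do rewrite big_nil; exact: integrable0.
  by under eq_Rintegral do rewrite big_nil; rewrite big_nil /Rintegral integral0.
have E t : \sum_(j <- i :: s) c j * G j t = c i * G i t + \sum_(j <- s) c j * G j t.
  by rewrite big_cons.
split.
  under eq_fun do rewrite E.
  exact: (@integrableD _ _ _ mu _ mD _ _ (iZ i) si).
under eq_Rintegral do rewrite E.
by rewrite RintegralD// IHs big_cons RintegralZl.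
Qed.

End general_integrals.

(** * Directional derivatives and the mean value inequality *)

Section general_derivatives.
Context {R : realType}.

(** A directional derivative depends only on the restriction to one line. This transports
    derivatives between [R], [R^m] and the fibres of [cons_rV]. *)
Lemma is_derive_congr (V W : normedModType R) (f : V -> R) (F : W -> R) a v b w (d : R) :
  (forall h : R, f (h *: v + a) = F (h *: w + b)) ->
  is_derive a v f d -> is_derive b w F d.
Proof.
move=> fF [df fd]; have faFb : f a = F b by have := fF 0; rewrite !scale0r !add0r.
have E : (fun h : R => h^-1 *: ((f \o shift a) (h *: v) - f a)) =
         (fun h : R => h^-1 *: ((F \o shift b) (h *: w) - F b)).
  by apply/funext => h; rewrite /= fF faFb.
by split; [move: df; rewrite /derivable E|move: fd; rewrite /derive E].
Qed.

(** On a line, [f] is a function of one real variable, where the chain rule with [s |-> c s] applies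
    for every [c], zero included. *)
Lemma is_derive_scale (V : normedModType R) (f : V -> R) a v (c d : R) :
  is_derive a v f d -> is_derive a (c *: v) f (c * d).
Proof.
move=> fd.
have f1 : is_derive (0 : R) 1 (fun s => f (s *: v + a)) d.
  apply: is_derive_congr fd => h.
  by rewrite /GRing.scale/= mulr1 addr0.
have f2 : is_derive (0 : R) 1 ((fun s => f (s *: v + a)) \o ( *%R c)) (c * d).
  have fc : is_derive (c *: (0 : R)) 1 (fun s => f (s *: v + a)) d by rewrite scaler0.
  have cc := is_deriveZ c (is_derive_id (0 : R) 1).
  have := is_derive1_comp fc cc.
  by rewrite /GRing.scale/= mulr1 mulrC.
apply: is_derive_congr f2 => h.
by rewrite /= addr0 [h *: 1]mulr1 mulrC -scalerA.
Qed.

Lemma bounded_fun_ub T (f : T -> R) : bounded_fun f ->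
  exists2 C : R, 0 <= C & forall x, `|f x| <= C.
Proof.
(* [bounded_fun] provides the bound only for constants strictly greater than [M]. *)
move=> [M [_ fM]]; exists (`|M| + 1) => [|x]; first by rewrite addr_ge0.
by apply: fM => //; rewrite (le_lt_trans (ler_norm M))// ltrDl.
Qed.

Lemma bounded_funs_ub (I : finType) T (f : I -> T -> R) :
  (forall i, bounded_fun (f i)) -> exists2 C : R, 0 <= C & forall i x, `|f i x| <= C.
Proof.
move=> bf.
have /choice[C fC] : forall i, exists C, 0 <= C /\ forall x, `|f i x| <= C.
  by move=> i; have [C C0 fC] := bounded_fun_ub (bf i); exists C.
exists (\sum_i C i) => [|i x]; first by apply: sumr_ge0 => i _; have [] := fC i.
rewrite (bigD1 i)//= (le_trans ((fC i).2 x))// lerDl sumr_ge0// => j _.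
by have [] := fC j.
Qed.

(** The derivative is controlled on a symmetric interval around [a], so that [b] may lie on either
    side: coordinates of an increment have no fixed sign. *)
Lemma mvt_le (g dg : R -> R) (a b K : R) :
  (forall s : R, is_derive s 1 g (dg s)) ->
  (forall s, `|s - a| <= `|b - a| -> `|dg s| <= K) ->
  `|g b - g a| <= K * `|b - a|.
Proof.
move=> gdg dgK.
have cg : continuous g.
  by move=> x; apply/differentiable_continuous/derivable1_diffP; have [] := gdg x.
have [ab|/ltW ba] := leP a b.
  have [|c] := @MVT_segment _ g dg a b ab _; first exact: continuous_subspaceT.
  rewrite in_itv/= => /andP[ac cb] ->; rewrite normrM ler_wpM2r//.
  by apply: dgK; rewrite !ger0_norm ?subr_ge0// lerB.
have [|c] := @MVT_segment _ g dg b a ba _; first exact: continuous_subspaceT.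
rewrite in_itv/= => /andP[bc ca] E; rewrite distrC E normrM (distrC b a) ler_wpM2r//.
by apply: dgK; rewrite distrC (distrC b a) !ger0_norm ?subr_ge0// lerB.
Qed.

End general_derivatives.

(** * Row vectors: sup norm, measurability, Euclidean pairing *)

Section row_vectors.
Context {R : realType}.

Lemma ler_mx_norm_rV m (x : 'rV[R]_m) (e : R) : 0 <= e ->
  (forall i, `|x 0 i| <= e) -> `|x| <= e.
Proof.
move=> e0 xe; rewrite -[leLHS]/(mx_norm x) mx_normrE.
by apply/bigmax_leP; split => // -[i j] _ /=; rewrite (ord1 i).
Qed.

Lemma coord_le_norm m (x : 'rV[R]_m) i : `|x 0 i| <= `|x|.
Proof.
rewrite -[leRHS]/(mx_norm x) mx_normrE.
exact: (le_bigmax _ (fun ij : 'I_1 * 'I_m => `|x ij.1 ij.2|) (0, i)).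
Qed.

(* f is the pointwise limit of x |-> f (floor (n x) / n), and the latter factor
   through a countable type. *)
Lemma continuous_measurable_rV m (f : 'rV[R]_m -> R) :
  continuous f -> measurable_fun setT f.
Proof.
move=> cf.
pose k n (x : 'rV[R]_m) : 'rV[int]_m := \row_i floor (x 0 i * n.+1%:R).
pose r n (z : 'rV[int]_m) : 'rV[R]_m := \row_i ((z 0 i)%:~R / n.+1%:R).
apply: (@measurable_fun_cvg _ _ _ _ (fun n x => f (r n (k n x)))).
  move=> n _ A mA; rewrite setTI.
  rewrite (_ : _ @^-1` A = \bigcup_(z in [set z | A (f (r n z))])
    \big[setI/setT]_(i < m) [set x : 'rV[R]_m | floor (x 0 i * n.+1%:R) = z 0 i]); last first.
    apply/seteqP; split => x /=.
      move=> Ax; exists (k n x) => //=; rewrite -bigcap_seq => i _ /=.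
      by rewrite mxE.
    move=> [z /= Az]; rewrite -bigcap_seq => xz.
    suff -> : k n x = z by [].
    by apply/rowP => i; rewrite mxE; apply: xz; rewrite /= mem_index_enum.
  rewrite bigcup_mkcond; apply: countable_bigcupT_measurable => // z.
  case: ifPn => // _; apply: bigsetI_measurable => i _.
  rewrite (_ : [set _ | _] = (fun x : 'rV[R]_m => x 0 i * n.+1%:R) @^-1`
    `[(z 0 i)%:~R, (z 0 i + 1)%:~R[%classic); last first.
    apply/seteqP; split => x /=; rewrite in_itv/=.
      by move=> <-; rewrite floor_le floorD1_gt.
    move=> /floor_def; exact.
  rewrite -[X in measurable X]setTI.
  apply: measurable_funM => //; exact: measurable_coord.
move=> x _.
have rx : r n (k n x) @[n --> \oo] --> x.
  apply/cvgrPdist_le => e e0; near=> n.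
  apply: ler_mx_norm_rV; first exact: ltW.
  move=> i; rewrite !mxE.
  have n0 : (0 : R) < n.+1%:R by rewrite ltr0n.
  rewrite -[X in `|X - _|](mulfK (lt0r_neq0 n0)) -mulrBl normrM.
  rewrite [X in _ * X]gtr0_norm ?invr_gt0// ler_pdivrMr// ger0_norm ?subr_ge0 ?floor_le//.
  apply: (@le_trans _ _ 1).
    by rewrite lerBlDl -[1]/(1%:~R) -intrD ltW// floorD1_gt.
  rewrite -ler_pdivrMl// mulr1 -natr1 ler_wpDr//.
  near: n; exact: nbhs_infty_ger.
exact: (cvg_comp _ _ rx (cf x)).
Unshelve. all: by end_near. Qed.

Definition rdot m (h y : 'rV[R]_m) : R := \sum_i h 0 i * y 0 i.

Lemma rdotC m (h y : 'rV[R]_m) : rdot h y = rdot y h.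
Proof. by apply: eq_bigr => i _; rewrite mulrC. Qed.

Lemma rdot_delta m i (y : 'rV[R]_m) : rdot (delta_mx 0 i) y = y 0 i.
Proof.
rewrite /rdot (bigD1 i)//= !mxE !eqxx mul1r big1 ?addr0// => j ji.
by rewrite mxE (negbTE ji) andbF mul0r.
Qed.

Lemma rdotDZ m (c y e : 'rV[R]_m) (t : R) : rdot c (t *: e + y) = rdot c y + rdot c e * t.
Proof.
rewrite /rdot mulr_suml -big_split; apply: eq_bigr => i _ /=.
by rewrite !mxE; ring.
Qed.

Lemma rdot_linear m (c : 'rV[R]_m) : linear (rdot c).
Proof.
move=> a u v; rewrite rdotDZ addrC; congr (_ + _); exact: mulrC.
Qed.

(** A candidate differential must be a bundled linear map for [diff_unique] to apply. *)
HB.instance Definition _ m (c : 'rV[R]_m) :=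
  GRing.isLinear.Build R 'rV[R]_m R *:%R (rdot c) (rdot_linear c).

Lemma enormE m (h : 'rV[R]_m) : enorm h = sqrtr (rdot h h).
Proof. by []. Qed.

Lemma rdot_ge0 m (h : 'rV[R]_m) : 0 <= rdot h h.
Proof. by apply: sumr_ge0 => i _; rewrite -expr2 sqr_ge0. Qed.

Lemma rdot0_enorm m (h : 'rV[R]_m) : enorm h = 0 -> h = 0.
Proof.
move=> /eqP; rewrite enormE sqrtr_eq0 => h0; apply: mulmx_tr_eq0.
by rewrite mxE; under eq_bigr do rewrite mxE.
Qed.

Lemma measurable_rdot m (h : 'rV[R]_m) : measurable_fun setT (rdot h).
Proof.
apply: measurable_sum => i; apply: measurable_funM => //; exact: measurable_coord.
Qed.

End row_vectors.

(** * Gaussian integration by parts *)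

Section normal01.
Context {R : realType}.
Local Notation mu := (@lebesgue_measure R).
Local Notation N := (@normal_prob R 0 1).
Local Notation phi := (@normal_pdf R 0 1).

Lemma is_derive_normal_pdf01 (x : R) : is_derive x 1 phi (- x * phi x).
Proof.
rewrite normal_pdfE ?oner_eq0//.
rewrite (_ : (fun _ => _) =
  normal_peak 1 \*: (expR \o (fun x : R => (- (x - 0) ^+ 2 / (1 ^+ 2 *+ 2))))); last first.
  by apply/funext.
rewrite /normal_fun.
apply: is_derive_eq.
by rewrite /= /GRing.scale/= subr0 !expr1n; field.
Qed.

(** The Radon-Nikodym derivative of [N] is determined only almost everywhere; it is compared with
    [phi] through the equality of their integrals over measurable subsets of [U]. *)
Lemma integral_normal_prob01 (f : R -> R) U : measurable U ->
  N.-integrable U (EFin \o f) ->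
  (\int[N]_(x in U) (f x)%:E = \int[mu]_(x in U) (f x * phi x)%:E)%E.
Proof.
move=> mU fi.
rewrite -(Radon_Nikodym_change_of_variables (normal_prob_dominates 0 1))//=.
have mf := measurable_int _ fi.
apply: ae_eq_integral => //.
- apply: emeasurable_funM => //; apply: (measurable_int mu).
  apply: (integrableS _ _ (@subsetT _ _)) => //=.
  by apply: Radon_Nikodym_integrable; exact: normal_prob_dominates.
- apply/measurable_EFinP; apply: measurable_funM.
    exact/measurable_EFinP.
  by apply/measurable_funTS; exact: measurable_normal_pdf.
- under [X in ae_eq _ _ _ X]eq_fun do rewrite EFinM.
  apply: ae_eqe_mul2l => /=.
  rewrite Radon_NikodymE//=; first exact: normal_prob_dominates.
  move=> abmu.
  case: cid => /= h [h1 h2 h3].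
  apply: integral_ae_eq => //=.
  + exact: integrableS h2.
  + by apply/measurable_funTS/measurableT_comp =>//; exact: measurable_normal_pdf.
  + by move=> E E01 mE; rewrite -h3.
Qed.

(* [g' - x g] times the density is the derivative of [g] times the density. *)
Lemma integral_normal_stein_itv (g dg : R -> R) (n : R) : 0 < n ->
  (forall x : R, is_derive x 1 g (dg x)) -> continuous dg ->
  (\int[N]_(x in `[(- n)%R, n]) (dg x - g x * x)%:E =
    (g n * phi n - g (- n) * phi (- n))%:E)%E.
Proof.
move=> n0 gdg cdg.
have cg : continuous g.
  by move=> x; apply/differentiable_continuous/derivable1_diffP; have [] := gdg x.
have ch : continuous (fun x => dg x - g x * x).
  by move=> x; apply: cvgB; [exact: cdg|apply: cvgM; [exact: cg|exact: cvg_id]].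
have cphi : continuous phi by apply: continuous_normal_pdf; rewrite oner_eq0.
have cgphi : continuous (g \* phi) by move=> x; apply: cvgM; [exact: cg|exact: cphi].
have dgphi (x : R) : is_derive x 1 (g \* phi) ((dg x - g x * x) * phi x).
  have := gdg x; have := is_derive_normal_pdf01 x => ? ?.
  apply: is_derive_eq; rewrite /= /GRing.scale/=; ring.
have nn : - n < n by rewrite gtrN.
rewrite integral_normal_prob01//; last first.
  have /compact_bounded[M [_ Mh]] : compact ((fun x => dg x - g x * x) @` `[- n, n]).
    apply: continuous_compact; last exact: segment_compact.
    exact: continuous_subspaceT.
  apply: (@bounded_integrable_prob _ _ _ _ _ (M + 1)) => //.
    exact: continuous_measurable_fun.
  by move=> x nx; apply: Mh; [rewrite ltrDl|exists x].
rewrite (@continuous_FTC2 _ _ (g \* phi))//.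
- apply: continuous_subspaceT => x.
  by apply: cvgM; [exact: ch|exact: cphi].
- split.
  + by move=> x _; have [] := dgphi x.
  + exact/cvg_at_right_filter/cgphi.
  + exact/cvg_at_left_filter/cgphi.
- by move=> x _; rewrite derive1E; have [] := dgphi x.
Qed.

(** The index is [n.+1] so that no interval is degenerate: the identity on [[- n, n]] requires
    [0 < n]. *)
Lemma bigcup_itv_sym : \bigcup_n `[- n.+1%:R, n.+1%:R]%classic = [set: R].
Proof.
rewrite -subTset => x _; exists (truncn `|x|) => //=.
by rewrite in_itv/= -ler_norml ltW// truncnS_gt.
Qed.

Lemma nondecreasing_itv_sym :
  nondecreasing_seq (fun n => `[- n.+1%:R, n.+1%:R]%classic : set R).
Proof.
move=> m n mn; apply/subsetPset => x /=; rewrite !in_itv/= -!ler_norml => xm.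
by rewrite (le_trans xm)// ler_nat ltnS.
Qed.

Lemma normal_pdf01N (x : R) : phi (- x) = phi x.
Proof. by rewrite !normal_pdfE ?oner_eq0// /normal_fun !subr0 sqrrN. Qed.

Lemma integrable_sqr_itv (n : R) : N.-integrable `[- n, n] (fun x : R => (x * x)%:E).
Proof.
apply: (@bounded_integrable_prob _ _ _ _ _ (n * n)) => //.
  exact: measurable_funM.
move=> x /=; rewrite in_itv/= -ler_norml => xn.
by rewrite normrM ler_pM.
Qed.

(** The case [g = id] of the identity on [[- n, n]]. It is used twice: the right side is
    nonnegative, which bounds the second moment by 1, and the left side is at most 1, which forces
    [phi n <= 1 / n]. *)
Lemma sqr_itv_stein (n : R) : 0 < n ->
  (N `[(- n)%R, n] - \int[N]_(x in `[(- n)%R, n]) (x * x)%:E = (2 * n * phi n)%:E)%E.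
Proof.
move=> n0; have := @integral_normal_stein_itv id (fun=> 1) _ n0 _ _.
rewrite normal_pdf01N (_ : n * _ - _ = 2 * n * phi n); last by ring.
move=> <-//; last exact: cst_continuous.
under [RHS]eq_integral do rewrite EFinB.
rewrite integralB//=; last 2 first.
- exact: finite_measure_integrable_cst.
- exact: integrable_sqr_itv.
by rewrite integral_cst// mul1e.
Qed.

Lemma sqr_itv_fin_num (n : R) : (\int[N]_(x in `[(- n)%R, n]) (x * x)%:E)%E \is a fin_num.
Proof. by apply: integrable_fin_num => //; exact: integrable_sqr_itv. Qed.

Lemma normal_sqr_le1 : (\int[N]_x (x * x)%:E <= 1)%E.
Proof.
have c : (\int[N]_(x in `[(- i.+1%:R)%R, i.+1%:R]) (x * x)%:E)%E @[i --> \oo] -->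
    (\int[N]_(x in \bigcup_n `[(- n.+1%:R)%R, n.+1%:R]%classic) (x * x)%:E)%E.
  apply: (@ge0_nondecreasing_set_cvg_integral _ _ R _
    (fun x : measurableTypeR R => (x * x)%:E) N nondecreasing_itv_sym) => //.
  - by move=> n; apply/measurable_EFinP; apply: measurable_funM.
  - by move=> n x _; rewrite lee_fin -expr2 sqr_ge0.
rewrite -bigcup_itv_sym; apply: (cvge_le _ c).
apply: nearW => n; have n0 : (0 : R) < n.+1%:R by rewrite ltr0n.
apply: (@le_trans _ _ (N `[- n.+1%:R, n.+1%:R]%classic)); last exact: probability_le1.
rewrite -sube_ge0 ?sqr_itv_fin_num//.
by rewrite sqr_itv_stein// lee_fin !mulr_ge0// normal_pdf_ge0.
Qed.

Lemma integrable_normal_sqr : N.-integrable setT (fun x : R => (x * x)%:E).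
Proof.
apply/integrableP; split.
  by apply/measurable_EFinP; exact: measurable_funM.
under eq_integral => x _ do rewrite gee0_abs ?lee_fin -?expr2 ?sqr_ge0// expr2.
by rewrite (le_lt_trans normal_sqr_le1)// ltry.
Qed.

Lemma integrable_normal_id : N.-integrable setT (fun x : R => x%:E).
Proof. exact: (@integrable_of_sqr _ _ _ N id (@measurable_id _ _ _) integrable_normal_sqr). Qed.

Lemma normal_pdf01_cvg0 : phi n.+1%:R @[n --> \oo] --> 0.
Proof.
apply: (@squeeze_cvgr _ _ _ _ (fun=> 0) (@harmonic R)).
- apply: nearW => n; rewrite normal_pdf_ge0/=.
  have n0 : (0 : R) < n.+1%:R by rewrite ltr0n.
  rewrite /harmonic/= -[leRHS]mulr1 ler_pdivlMl// -lee_fin.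
  apply: (@le_trans _ _ (2 * n.+1%:R * phi n.+1%:R)%:E).
    by rewrite lee_fin -mulrA ler_peMl ?ler1n// mulr_ge0 ?normal_pdf_ge0// ltW.
  rewrite -sqr_itv_stein// leeBlDr ?sqr_itv_fin_num//.
  apply: (@le_trans _ _ 1%E); first exact: probability_le1.
  rewrite leeDl// integral_ge0// => x _; by rewrite lee_fin -expr2 sqr_ge0.
- exact: cvg_cst.
- exact: cvg_harmonic.
Qed.

Lemma cvg_integral_itv_sym (h : R -> R) : N.-integrable setT (EFin \o h) ->
  (\int[N]_(x in `[(- n.+1%:R)%R, n.+1%:R]) (h x)%:E)%E @[n --> \oo] -->
  (\int[N]_x (h x)%:E)%E.
Proof.
move=> ih; have mh := measurable_int _ ih.
under eq_cvg do rewrite integral_mkcond.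
have [|||||_ _ c] := @dominated_convergence _ _ R N setT measurableT
  (fun n => (EFin \o h) \_ (`[(- n.+1%:R)%R, n.+1%:R]%classic : set (measurableTypeR R)))
  (EFin \o h) (abse \o (EFin \o h)).
- move=> n; apply: (measurable_restrictT _ _).1; [exact: measurable_itv|exact: measurable_funS mh].
- exact: mh.
- apply: aeW => x _; apply: cvg_near_cst; near=> n.
  rewrite patchE ifT// inE/= in_itv/= -ler_norml -natr1 ler_wpDr//.
  near: n; exact: nbhs_infty_ger.
- exact: integrable_abse.
- apply: aeW => x n _; rewrite /= patchE; case: ifP => // _.
  by rewrite abse0.
exact: c.
Unshelve. all: by end_near. Qed.

(** The integrals over [[- n, n]] have two limits: the integral over the line, by dominated
    convergence, and 0, because the boundary terms are at most [2 C phi(n)]. *)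
Lemma integral_normal_stein (g dg : R -> R) (C : R) :
  (forall x : R, is_derive x 1 g (dg x)) -> continuous dg ->
  (forall x, `|g x| <= C) -> (forall x, `|dg x| <= C) ->
  (\int[N]_x (dg x)%:E = \int[N]_x (g x * x)%:E)%E.
Proof.
move=> gdg cdg gC dgC.
have mdg : measurable_fun setT dg by exact: continuous_measurable_fun.
have mg : measurable_fun setT g.
  apply: continuous_measurable_fun => x.
  by apply/differentiable_continuous/derivable1_diffP; have [] := gdg x.
have idg : N.-integrable setT (EFin \o dg) by apply: (@bounded_integrable_prob _ _ _ _ _ C).
have igx : N.-integrable setT (fun x => (g x * x)%:E).
  exact: (@bounded_mul_integrable _ _ _ N g id C mg gC integrable_normal_id).
have idgx : N.-integrable setT (EFin \o (fun x => dg x - g x * x)).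
  exact: (@integrableB _ _ _ _ _ measurableT _ _ idg igx).
have c1 := cvg_integral_itv_sym idgx.
have c2 : (\int[N]_(x in `[(- n.+1%:R)%R, n.+1%:R]) (dg x - g x * x)%:E)%E
    @[n --> \oo] --> (0%E : \bar R).
  under eq_cvg => n do rewrite (integral_normal_stein_itv _ gdg cdg) ?ltr0n// normal_pdf01N.
  apply: cvg_EFin; first exact: nearW.
  apply: (@squeeze_cvgr _ _ _ _ (fun n => - (2 * C * phi n.+1%:R)) (fun n => 2 * C * phi n.+1%:R)).
  - apply: nearW => n /=; rewrite -ler_norml -mulrBl normrM [X in _ * X]ger0_norm ?normal_pdf_ge0//.
    rewrite ler_wpM2r ?normal_pdf_ge0// mulr2n mulrDl mul1r.
    by rewrite (le_trans (ler_normB _ _))// lerD.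
  - rewrite -[X in _ --> X]oppr0 -[X in _ --> - X](mulr0 (2 * C)).
    by apply: cvgN; apply: cvgM; [exact: cvg_cst|exact: normal_pdf01_cvg0].
  - rewrite -[X in _ --> X](mulr0 (2 * C)); apply: cvgM; [exact: cvg_cst|exact: normal_pdf01_cvg0].
have E0 : (\int[N]_x (dg x - g x * x)%:E = 0)%E.
  by rewrite -(cvg_lim (@ereal_hausdorff R) c1); apply/cvg_lim.
move: E0; rewrite integralB_EFin//.
move/eqP; rewrite sube_eq ?add0e; first by move/eqP.
- exact: integrable_fin_num.
- by rewrite fin_num_adde_defl//; apply: integrable_fin_num.
Qed.

End normal01.

(** * The standard Gaussian on R^m, by induction on m *)

Section std_gaussian.
Context {R : realType}.
Local Notation N := (@normal_prob R 0 1).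

Lemma cons_rV0 m (x : R) (z : 'rV[R]_m) : cons_rV (x, z) 0 ord0 = x.
Proof.
rewrite /cons_rV (_ : ord0 = lshift m (ord0 : 'I_1)); last exact/val_inj.
by rewrite (@row_mxEl _ 1 1 m) mxE eqxx.
Qed.

Lemma cons_rVS m (x : R) (z : 'rV[R]_m) j : cons_rV (x, z) 0 (lift ord0 j) = z 0 j.
Proof.
rewrite /cons_rV (_ : lift ord0 j = rshift 1 j); last exact/val_inj.
by rewrite (@row_mxEr _ 1 1 m).
Qed.

(** With [cons_rV_shiftS], this turns a partial derivative on [R^(m+1)] into a derivative in [x] or
    in [z], through [is_derive_congr]. *)
Lemma cons_rV_shift0 m (x s : R) (z : 'rV[R]_m) :
  s *: delta_mx 0 ord0 + cons_rV (x, z) = cons_rV (s + x, z).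
Proof.
apply/rowP => i; have [->|] := eqVneq i ord0.
  by rewrite 3!mxE !cons_rV0 eqxx mulr1.
rewrite eq_sym => i0; have [j ->] := unlift_some i0.
by rewrite 3!mxE !cons_rVS /= mulr0 add0r.
Qed.

Lemma cons_rV_shiftS m (x s : R) (z : 'rV[R]_m) j :
  s *: delta_mx 0 (lift ord0 j) + cons_rV (x, z) = cons_rV (x, s *: delta_mx 0 j + z).
Proof.
apply/rowP => i; have [->|] := eqVneq i ord0.
  by rewrite 3!mxE !cons_rV0 mulr0 add0r.
rewrite eq_sym => i0; have [k ->] := unlift_some i0.
by rewrite 3!mxE !cons_rVS 3!mxE (inj_eq lift_inj).
Qed.

Lemma ge0_integral_std_gaussianS m (f : 'rV[R]_m.+1 -> \bar R) :
  measurable_fun setT f -> (forall y, 0 <= f y)%E ->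
  (\int[std_gaussian m.+1]_y f y =
   \int[N]_x \int[std_gaussian m]_z f (cons_rV (x, z)))%E.
Proof.
move=> mf f0 /=; rewrite ge0_integral_distribution//.
rewrite fubini_tonelli1//; last by move=> y; exact: f0.
by apply: measurableT_comp => //; exact: measurable_cons_rV.
Qed.

Lemma integrable_std_gaussianS m (f : 'rV[R]_m.+1 -> \bar R) :
  (std_gaussian m.+1).-integrable setT f ->
  (N \x std_gaussian m)%E.-integrable setT (f \o @cons_rV R m).
Proof.
move=> fi; have mf := measurable_int _ fi.
have mfc : measurable_fun setT (f \o @cons_rV R m).
  by apply: measurableT_comp => //; exact: measurable_cons_rV.
move/integrableP : fi => [_ fi]; apply/integrableP; split => //.
move: fi; rewrite ge0_integral_distribution//; exact: measurableT_comp.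
Qed.

Lemma integral_std_gaussianS m (f : 'rV[R]_m.+1 -> \bar R) :
  (std_gaussian m.+1).-integrable setT f ->
  (\int[std_gaussian m.+1]_y f y =
   \int[N]_x \int[std_gaussian m]_z f (cons_rV (x, z)))%E.
Proof.
move=> fi; have fci := integrable_std_gaussianS fi.
rewrite /= integral_distribution//; last exact: measurable_int fi.
by rewrite -(integral12_prod_meas1 fci).
Qed.

(** The first coordinate is integrated innermost, the order required to integrate by parts in that
    coordinate with [z] fixed. *)
Lemma integral_std_gaussianS_swap m (f : 'rV[R]_m.+1 -> \bar R) :
  (std_gaussian m.+1).-integrable setT f ->
  (\int[std_gaussian m.+1]_y f y =
   \int[std_gaussian m]_z \int[N]_x f (cons_rV (x, z)))%E.
Proof.
move=> fi; have fci := integrable_std_gaussianS fi.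
by rewrite integral_std_gaussianS// (Fubini fci).
Qed.

Lemma rdot_cons m (h : 'rV[R]_m.+1) (x : R) (z : 'rV[R]_m) :
  rdot h (cons_rV (x, z)) = h 0 ord0 * x + rdot (\row_(j < m) h 0 (lift ord0 j)) z.
Proof.
rewrite /rdot big_ord_recl cons_rV0; congr (_ + _).
by apply: eq_bigr => j _; rewrite cons_rVS mxE.
Qed.

Lemma integral_normal_id : (\int[N]_x x%:E = 0)%E.
Proof.
transitivity (\int[N]_x (cst 1 x * x)%:E)%E.
  by apply: eq_integral => x _; rewrite mul1r.
rewrite -(@integral_normal_stein _ (cst 1) (cst 0) 1).
- by rewrite integral0.
- exact: cst_continuous.
- by move=> x; rewrite normr1.
- by move=> x; rewrite normr0.
Qed.

(** One induction proves all three claims, since they feed each other: with [h = (a, k)], the square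
    of [a x + <k, z>] has a cross term that vanishes by the zero mean of [<k, z>], and the finite
    second moment is what makes the linear forms integrable. *)
Lemma std_gaussian_moments m (h : 'rV[R]_m) :
  [/\ (std_gaussian m).-integrable setT (fun y => (rdot h y * rdot h y)%:E),
      (\int[std_gaussian m]_y (rdot h y)%:E = 0)%E &
      (\int[std_gaussian m]_y (rdot h y * rdot h y)%:E <= (rdot h h)%:E)%E].
Proof.
elim: m h => [|m IHm] h.
  have r0 (k y : 'rV[R]_0) : rdot k y = 0 by rewrite /rdot big_ord0.
  split.
  - under eq_fun do rewrite r0 mul0r; exact: integrable0.
  - by under eq_integral do rewrite r0; rewrite integral0.
  - by under eq_integral do rewrite r0 mul0r; rewrite integral0 r0.
pose k : 'rV[R]_m := \row_(j < m) h 0 (lift ord0 j); have [ik2 k0 k2] := IHm k.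
have ik := integrable_of_sqr (measurable_rdot k) ik2.
set a := h 0 ord0.
have mh := measurable_rdot h.
have mh2 : measurable_fun setT (fun y => (rdot h y * rdot h y)%:E).
  by apply/measurable_EFinP; exact: measurable_funM.
have [s sE] : exists s : R, (\int[std_gaussian m]_z (rdot k z * rdot k z)%:E = s%:E)%E.
  by eexists; rewrite -[LHS]fineK//; apply: integrable_fin_num.
rewrite sE in k2.
have s0 : 0 <= s.
  by rewrite -lee_fin -sE integral_ge0// => z _; rewrite lee_fin -expr2 sqr_ge0.
have inner x : (\int[std_gaussian m]_z
    (rdot h (cons_rV (x, z)) * rdot h (cons_rV (x, z)))%:E =
  (a ^+ 2)%:E * (x * x)%:E + s%:E)%E.
  transitivity (\int[std_gaussian m]_z
    (((a * x) ^+ 2 + (2 * a * x) * rdot k z) + (rdot k z * rdot k z))%:E)%E.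
    by apply: eq_integral => z _; rewrite rdot_cons -/k -/a; congr EFin; ring.
  have i1 : (std_gaussian m).-integrable setT (EFin \o cst ((a * x) ^+ 2)).
    exact: finite_measure_integrable_cst.
  have i2 : (std_gaussian m).-integrable setT (EFin \o (fun z => (2 * a * x) * rdot k z)).
    exact: (@integrableZl _ _ _ _ _ measurableT (2 * a * x) _ ik).
  rewrite integralD_EFin//; last exact: (integrableD measurableT i1 i2).
  rewrite integralD_EFin//.
  rewrite integral_prob_cst.
  under [X in (_ + X + _)%E]eq_integral do rewrite /= EFinM.
  by rewrite integralZl// k0 mule0 adde0 sE exprMn EFinM expr2.
have E2 : (\int[std_gaussian m.+1]_y (rdot h y * rdot h y)%:E =
    (a ^+ 2)%:E * \int[N]_x (x * x)%:E + s%:E)%E.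
  rewrite ge0_integral_std_gaussianS//; last first.
    by move=> y; rewrite lee_fin -expr2 sqr_ge0.
  under eq_integral do rewrite inner.
  rewrite ge0_integralD//.
  - rewrite integral_prob_cst integralZl//.
    exact: integrable_normal_sqr.
  - by move=> x _; rewrite -EFinM lee_fin mulr_ge0 ?sqr_ge0// -expr2 sqr_ge0.
  - by apply/measurable_EFinP; apply: measurable_funM => //; apply: measurable_funM.
have h2 : (\int[std_gaussian m.+1]_y (rdot h y * rdot h y)%:E <= (rdot h h)%:E)%E.
  rewrite E2 [in leRHS]/rdot big_ord_recl EFinD leeD//.
    rewrite -expr2 -[leRHS]mule1; apply: lee_wpmul2l; last exact: normal_sqr_le1.
    by rewrite lee_fin sqr_ge0.
  rewrite (le_trans k2)// lee_fin /rdot le_eqVlt; apply/orP; left; apply/eqP.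
  by apply: eq_bigr => j _; rewrite mxE.
have ih2 : (std_gaussian m.+1).-integrable setT (fun y => (rdot h y * rdot h y)%:E).
  apply/integrableP; split => //.
  under eq_integral => y _ do rewrite gee0_abs ?lee_fin -?expr2 ?sqr_ge0// expr2.
  by rewrite (le_lt_trans h2)// ltry.
split => //.
have ih := integrable_of_sqr mh ih2.
rewrite (integral_std_gaussianS ih).
transitivity (\int[N]_x (a * x)%:E)%E.
  apply: eq_integral => x _; under eq_integral do rewrite /= rdot_cons -/k -/a.
  rewrite integralD_EFin//; last exact: finite_measure_integrable_cst.
  by rewrite k0 adde0 integral_prob_cst.
under eq_integral do rewrite EFinM.
by rewrite integralZl ?integral_normal_id ?mule0//; exact: integrable_normal_id.
Qed.

Lemma integrable_std_gaussian_rdot m (h : 'rV[R]_m) :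
  (std_gaussian m).-integrable setT (EFin \o rdot h).
Proof.
have [h2 _ _] := std_gaussian_moments h.
exact: integrable_of_sqr (measurable_rdot h) h2.
Qed.

Lemma integrable_std_gaussian_coord m i :
  (std_gaussian m).-integrable setT (fun y : 'rV[R]_m => (y 0 i)%:E).
Proof.
apply: eq_integrable (integrable_std_gaussian_rdot (delta_mx 0 i)) => //.
by move=> y _ /=; rewrite rdot_delta.
Qed.

(* By Fubini, from the one-dimensional case. *)
Lemma std_gaussian_stein m (i : 'I_m) (g dg : 'rV[R]_m -> R) (C : R) :
  measurable_fun setT g -> measurable_fun setT dg ->
  (forall y, `|g y| <= C) -> (forall y, `|dg y| <= C) ->
  (forall y, is_derive y (delta_mx 0 i) g (dg y)) ->
  (forall y, continuous (fun s : R => dg (s *: delta_mx 0 i + y))) ->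
  (\int[std_gaussian m]_y (dg y)%:E = \int[std_gaussian m]_y (g y * y 0 i)%:E)%E.
Proof.
elim: m i g dg => [[]//|m IHm] i g dg mg mdg gC dgC gdg cdg.
have idg : (std_gaussian m.+1).-integrable setT (EFin \o dg).
  exact: (@bounded_integrable_prob _ _ _ _ _ C).
have ig : (std_gaussian m.+1).-integrable setT (fun y => (g y * y 0 i)%:E).
  exact: (@bounded_mul_integrable _ _ _ _ g (fun y => y 0 i) C mg gC
    (integrable_std_gaussian_coord i)).
have [i0|] := eqVneq i ord0.
  rewrite (integral_std_gaussianS_swap idg) (integral_std_gaussianS_swap ig).
  apply: eq_integral => z _; rewrite i0 in gdg cdg *.
  under [RHS]eq_integral do rewrite cons_rV0.
  apply: (@integral_normal_stein _ (fun x => g (cons_rV (x, z)))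
    (fun x => dg (cons_rV (x, z))) C) => //.
  - move=> x; apply: is_derive_congr (gdg (cons_rV (x, z))) => h.
    by rewrite cons_rV_shift0 /GRing.scale/= mulr1.
  - rewrite (_ : (fun _ => _) = (fun s : R => dg (s *: delta_mx 0 ord0 + cons_rV (0, z)))).
      exact: cdg.
    by apply/funext => x; rewrite cons_rV_shift0 addr0.
rewrite eq_sym => i0; have [j ij _] := unlift_some i0; rewrite {}ij in gdg cdg ig *.
rewrite (integral_std_gaussianS idg) (integral_std_gaussianS ig).
apply: eq_integral => x _.
under [RHS]eq_integral do rewrite cons_rVS.
have mc : measurable_fun setT (fun z => cons_rV (x, z) : 'rV[R]_m.+1).
  exact: measurableT_comp (@measurable_cons_rV R m) _.
apply: (IHm j (fun z => g (cons_rV (x, z))) (fun z => dg (cons_rV (x, z)))) => //.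
- exact: measurableT_comp mg mc.
- exact: measurableT_comp mdg mc.
- move=> z; apply: is_derive_congr (gdg (cons_rV (x, z))) => h.
  by rewrite cons_rV_shiftS.
- move=> z; rewrite (_ : (fun _ => _) =
    (fun s : R => dg (s *: delta_mx 0 (lift ord0 j) + cons_rV (x, z)))).
    exact: cdg.
  by apply/funext => s; rewrite cons_rV_shiftS.
Qed.

End std_gaussian.

(** * Taylor remainders *)

Section taylor.
Context {R : realType}.

(** The path from [x] to [x + h] changes one coordinate at a time; each of its [m] legs costs at
    most [K |h|] by the mean value inequality. In the sup norm the whole path stays within distance
    [|h|] of [x], so the partial derivatives need control only there. *)
Lemma partials_increment_le m (g : 'rV[R]_m -> R) (dg : 'I_m -> 'rV[R]_m -> R)
    (K : R) (x h : 'rV[R]_m) :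
  (forall i y, is_derive y (delta_mx 0 i) g (dg i y)) ->
  (forall i y, `|y - x| <= `|h| -> `|dg i y| <= K) ->
  `|g (x + h) - g x| <= m%:R * K * `|h|.
Proof.
move=> gdg dgK.
(* [p k] is the vertex of the path at which the first [k] coordinates have been moved. *)
pose p (k : nat) : 'rV[R]_m := \row_i (x 0 i + (if (i < k)%N then h 0 i else 0)).
have -> : x + h = p m by apply/rowP => i; rewrite !mxE ltn_ord.
have p0 : p 0 = x by apply/rowP => i; rewrite !mxE addr0.
suff H k : (k <= m)%N -> `|g (p k) - g x| <= k%:R * K * `|h| by exact: H.
elim: k => [_|k IHk km]; first by rewrite p0 subrr normr0 !mul0r.
rewrite -(subrKA (g (p k))) (le_trans (ler_normD _ _))// -natr1 !mulrDl mul1r addrC.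
apply: lerD; first exact/IHk/ltnW.
pose i := Ordinal km.
have pS : p k.+1 = h 0 i *: delta_mx 0 i + p k.
  apply/rowP => j; rewrite !mxE eqxx/= ltnS leq_eqVlt -[(j == k :> nat)]/(j == i).
  have [->|ji] := eqVneq j i; first by rewrite mulr1 ltnn addr0 addrC.
  by rewrite mulr0 add0r.
have := @mvt_le _ (fun s => g (s *: delta_mx 0 i + p k))
  (fun s => dg i (s *: delta_mx 0 i + p k)) 0 (h 0 i) K.
rewrite scale0r add0r -pS subr0 => H.
apply: (le_trans (H _ _)).
- move=> s; apply: is_derive_congr (gdg i _) => t.
  by rewrite addrA -scalerDl /GRing.scale/= mulr1.
- move=> s; rewrite subr0 => sh; apply: dgK.
  apply: ler_mx_norm_rV => // j; rewrite !mxE eqxx/=.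
  have [->|ji] := eqVneq j i.
    by rewrite mulr1 ltnn addr0 addrK (le_trans sh)// coord_le_norm.
  rewrite mulr0 add0r addrAC subrr add0r; case: ifP => _; first exact: coord_le_norm.
  by rewrite normr0.
- apply: ler_wpM2l; last exact: coord_le_norm.
  by rewrite (le_trans _ (dgK i x _))// subrr normr0.
Qed.

Lemma is_derive_rdot m (c y e : 'rV[R]_m) : is_derive y e (rdot c) (rdot c e).
Proof.
apply: (@is_derive_congr _ _ _ (fun t : R => rdot c y + rdot c e * t) _ 0 1).
  by move=> t; rewrite rdotDZ addr0 /GRing.scale/= mulr1.
have := @is_deriveD _ _ _ _ _ _ _ _ _ (is_derive_cst (rdot c y) (0 : R) 1)
  (is_deriveZ (rdot c e) (is_derive_id (0 : R) 1)).
by rewrite add0r /GRing.scale/= mulr1.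
Qed.

(* The remainder is the increment of [f] minus its linear part at [x], whose
   partial derivatives are small near [x] by the same increment bound. *)
Lemma C2_taylor m (f : 'rV[R]_m -> R) (df : 'I_m -> 'rV[R]_m -> R)
    (ddf : 'I_m -> 'I_m -> 'rV[R]_m -> R) (C : R) :
  (forall i y, is_derive y (delta_mx 0 i) f (df i y)) ->
  (forall i j y, is_derive y (delta_mx 0 j) (df i) (ddf i j y)) ->
  (forall i j y, `|ddf i j y| <= C) ->
  forall x h, `|f (x + h) - f x - rdot (\row_i df i x) h| <= m%:R * (m%:R * C) * `|h| ^+ 2.
Proof.
move=> fdf dfddf ddfC x h; set c := \row_i df i x.
have := @partials_increment_le m (f \- rdot c)
  (fun i y => df i y - c 0 i) (m%:R * C * `|h|) x h.
have rD : rdot c (x + h) = rdot c x + rdot c h.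
  by rewrite -{1}[h]scale1r addrC rdotDZ mulr1.
rewrite /= rD.
set u := (X in _ -> _ -> `|X| <= _); have -> : u = f (x + h) - f x - rdot c h.
  by rewrite /u; ring.
rewrite expr2 !mulrA; apply.
- move=> i y; rewrite -(rdot_delta i c).
  rewrite rdotC.
  have := fdf i y; have := is_derive_rdot c y (delta_mx 0 i) => ? ?.
  exact: is_deriveB.
- move=> i y yxh; rewrite mxE.
  have := @partials_increment_le m (df i) (ddf i) C x (y - x) (dfddf i).
  rewrite (addrC x) subrK => H; apply: (le_trans (H _)) => //.
  rewrite ler_wpM2l// mulr_ge0//.
  by rewrite (le_trans _ (ddfC i i x)).
Qed.

End taylor.

(** * The resolvent *)

Section time_integral.
Context {R : realType}.
Local Notation mu := (@lebesgue_measure R).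

Lemma integral_expRN : (\int[mu]_(t in `[0%R, +oo[) (expR (- t))%:E = 1)%E.
Proof.
rewrite -(@integral_exponential_pdf R 1)// [LHS]integral_mkcond.
apply: eq_integral => t _; rewrite /exponential_pdf restrict_EFin.
by congr EFin; rewrite !patchE; case: ifP => // _; rewrite mul1r mulN1r.
Qed.

Lemma continuous_expRN (c : R) : continuous (fun t : R => expR (- (c * t))).
Proof.
move=> t; apply: (@continuous_comp _ _ _ (fun t => - (c * t)) expR).
  by apply: cvgN; apply: cvgM; [exact: cvg_cst|exact: cvg_id].
exact: continuous_expR.
Qed.

Lemma measurable_expRN : measurable_fun setT (fun t : R => expR (- t)).
Proof.
rewrite (_ : (fun _ => _) = fun t => expR (- (1 * t))); last first.
  by apply/funext => t; rewrite mul1r.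
apply: continuous_measurable_fun; exact: (continuous_expRN (c := 1)).
Qed.

Lemma integrable_expRN : mu.-integrable `[0, +oo[ (EFin \o (fun t : R => expR (- t))).
Proof.
apply/integrableP; split.
  by apply/measurable_EFinP; apply: measurable_funTS; exact: measurable_expRN.
under eq_integral do rewrite /= ger0_norm ?expR_ge0//.
by rewrite integral_expRN ltry.
Qed.

Lemma integrable_expRNM (phi : R -> R) (C : R) : measurable_fun setT phi ->
  (forall t, 0 <= t -> `|phi t| <= C) ->
  mu.-integrable `[0, +oo[ (EFin \o (fun t => expR (- t) * phi t)).
Proof.
move=> mphi phiC.
apply: (@le_integrable _ _ _ _ _ _ _
  (fun t : measurableTypeR R => (C%:E * (expR (- t))%:E)%E)) => //.
- apply/measurable_EFinP; apply: measurable_funTS; apply: measurable_funM => //.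
  exact: measurable_expRN.
- move=> t; rewrite /= in_itv/= andbT => t0.
  rewrite lee_fin !normrM mulrC ler_wpM2r// (le_trans (phiC _ t0))// ler_norm//.
- apply: integrableZl => //; exact: integrable_expRN.
Qed.

Lemma Rintegral_expRNM_le (phi : R -> R) (C : R) : measurable_fun setT phi ->
  (forall t, 0 <= t -> `|phi t| <= C) ->
  `|\int[mu]_(t in `[0, +oo[) (expR (- t) * phi t)| <= C.
Proof.
move=> mphi phiC; have ip := integrable_expRNM mphi phiC.
apply: (le_trans (le_normr_Rintegral _ ip)) => //.
apply: (@le_trans _ _ (\int[mu]_(t in `[0, +oo[) (C * expR (- t)))).
  apply: le_Rintegral => //.
  - exact: integrable_norm.
  - exact: (@integrableZl _ _ _ mu _ (measurable_itv _) C _ integrable_expRN).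
  - move=> t; rewrite /= in_itv/= andbT => t0.
    by rewrite normrM ger0_norm ?expR_ge0// mulrC ler_wpM2r ?expR_ge0// phiC.
rewrite RintegralZl//; last exact: integrable_expRN.
by rewrite /Rintegral integral_expRN mulr1.
Qed.

Lemma asin0 : asin (0 : R) = 0.
Proof.
rewrite -[in LHS]sin0 sinK// in_itv/= oppr_le0 andbb.
by rewrite divr_ge0// pi_ge0.
Qed.

Variable lam : R.
Hypothesis lam0 : 0 < lam.

(** For [lam > 0] it blows up like [(2 lam t)^(-1/2)] as [t] decreases to 0, while the convention
    [0^-1 = 0] gives it the value 0 at [t = 0]. Bounds by this kernel are therefore stated for
    [0 < t] only, and its integral is computed from some [e > 0]. *)
Definition OU_kernel (t : R) : R :=
  expR (- (lam * t)) / sqrtr (1 - expR (- (2 * lam * t))).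

Lemma expRN_lt1 (c t : R) : 0 < c -> 0 < t -> expR (- (c * t)) < 1.
Proof. by move=> c0 t0; rewrite -[ltRHS]expR0 ltr_expR oppr_lt0 mulr_gt0. Qed.

Lemma expRN2 (t : R) : expR (- (2 * lam * t)) = expR (- (lam * t)) ^+ 2.
Proof. by rewrite -expRM_natl; congr expR; ring. Qed.

Lemma continuous_OU_kernel (e : R) : 0 < e -> {within `[e, +oo[, continuous OU_kernel}.
Proof.
move=> e0; apply: continuous_in_subspaceT => t; rewrite inE/= in_itv/= andbT => et.
have t0 := lt_le_trans e0 et.
apply: cvgM; first exact: continuous_expRN.
apply: cvgV.
  by rewrite gt_eqF// sqrtr_gt0 subr_gt0 expRN_lt1// mulr_gt0.
apply: (@continuous_comp _ _ _ (fun s => 1 - expR (- (2 * lam * s))) sqrtr).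
  apply: cvgB; [exact: cvg_cst|exact: continuous_expRN].
exact: sqrt_continuous.
Qed.

(* [OU_kernel] is the derivative of [- asin (e^(- lam t)) / lam]. *)
Lemma integral_OU_kernel_le (e : R) : 0 < e ->
  (\int[mu]_(t in `[e, +oo[) (OU_kernel t)%:E <= (pi / (2 * lam))%:E)%E.
Proof.
move=> e0.
pose F t := - lam^-1 * asin (expR (- (lam * t))).
have aI (t : R) : 0 < t -> -1 < expR (- (lam * t)) < 1.
  by move=> t0; rewrite expRN_lt1// andbT (lt_trans _ (expR_gt0 _))// oppr_lt0.
have dF (t : R) : 0 < t -> is_derive t 1 F (OU_kernel t).
  move=> t0; have := is_derive1_asin (aI _ t0) => ?.
  rewrite (_ : F = (- lam^-1) \*: (asin \o (expR \o (fun s => - (lam * s)))))//.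
  apply: is_derive_eq; rewrite /OU_kernel /GRing.scale/= expRN2.
  rewrite mulr1 mulNr !mulrN opprK (mulrC _ lam) (mulrCA _ lam) mulKf ?gt_eqF//.
  by rewrite mulrC.
have et t : e <= t -> 0 < t by exact: lt_le_trans.
rewrite (@ge0_continuous_FTC2y _ OU_kernel F e 0).
- rewrite /F -EFinB lee_fin sub0r mulNr opprK invfM mulrA mulrC.
  rewrite ler_wpM2r ?invr_ge0 ?(ltW lam0)//.
  by have /andP[? ?] := aI _ e0; rewrite asin_lepi2// !ltW.
- by move=> t _; rewrite mulr_ge0 ?expR_ge0// invr_ge0 sqrtr_ge0.
- exact: continuous_OU_kernel.
- rewrite -[X in _ --> X](mulr0 (- lam^-1)); apply: cvgM; first exact: cvg_cst.
  rewrite -[X in _ --> X]asin0.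
  apply: (@cvg_comp _ _ _ (fun t => expR (- (lam * t))) asin _ (nbhs (0 : R))); last first.
    by apply: continuous_asin; rewrite ltr01 oppr_lt0 ltr01.
  have : (lam * t) @[t --> +oo] --> +oo by apply: gt0_cvgMry => //; exact: cvg_id.
  move=> /(@cvg_comp _ _ _ (fun t => lam * t) (fun t => expR (- t)) _ _ _); apply.
  exact: cvgr_expR.
- by move=> t et'; have [] := dF t (lt_trans e0 et').
- apply: cvg_at_right_filter.
  by apply/differentiable_continuous/derivable1_diffP; have [] := dF e e0.
- by move=> t; rewrite in_itv/= andbT => et'; rewrite derive1E; have [] := dF t (lt_trans e0 et').
Qed.

(** An arbitrary error [d] pays for the singularity: on a short interval [[0, e[] the uniform bound
    [C] contributes at most [d], and beyond [e] the kernel bound applies. The final estimate does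
    not depend on [C]. *)
Lemma Rintegral_OU_kernel_le (phi : R -> R) (C A : R) : measurable_fun setT phi ->
  0 <= A ->
  (forall t, 0 <= t -> `|phi t| <= C) ->
  (forall t, 0 < t -> `|phi t| <= A * OU_kernel t) ->
  `|\int[mu]_(t in `[0, +oo[) (expR (- t) * phi t)| <= A * (pi / (2 * lam)).
Proof.
move=> mphi A0 phiC phiA; have ip := integrable_expRNM mphi phiC.
have C0 : 0 <= C by rewrite (le_trans _ (phiC 0 _)).
have k0 t : 0 <= OU_kernel t by rewrite mulr_ge0 ?expR_ge0// invr_ge0 sqrtr_ge0.
have mnphi : measurable_fun setT (fun t => `|phi t|%:E).
  by apply/measurable_EFinP; apply: measurableT_comp.
apply/ler_addgt0Pr => d d0; rewrite -lee_fin EFin_normr_Rintegral//.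
apply: (le_trans (le_abse_integral _ _ _)) => //; first exact: measurable_int ip.
apply: (@le_trans _ _ (\int[mu]_(t in `[0%R, +oo[) `|phi t|%:E)%E).
  apply: ge0_le_integral => //.
  - apply: measurableT_comp => //; exact: measurable_int ip.
  - exact: measurable_funTS.
  - move=> t; rewrite /= in_itv/= andbT => t0; rewrite lee_fin normrM.
    by rewrite ger0_norm ?expR_ge0// ler_piMl// -[leRHS]expR0 ler_expR oppr_le0.
(* Chosen so that [C e <= d]; the [+ 1] covers [C = 0]. *)
pose e := d / (C + 1).
have e0 : 0 < e by rewrite divr_gt0// ltr_wpDl.
have -> : `[0%R, +oo[%classic = `[0%R, e[%classic `|` `[e, +oo[%classic :> set R.
  by rewrite -itv_bndbnd_setU// bnd_simp// ltW.
rewrite ge0_integral_setU//=; last 2 first.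
- exact: measurable_funTS.
- apply/disj_setPS => t [] /=; rewrite !in_itv/= andbT => /andP[_ te] et.
  by have := lt_le_trans te et; rewrite ltxx.
have mk : measurable_fun `[e, +oo[ OU_kernel.
  apply: subspace_continuous_measurable_fun => //; exact: continuous_OU_kernel.
rewrite (addrC (A * _)) EFinD; apply: leeD.
  apply: (@le_trans _ _ (\int[mu]_(t in `[0%R, e[) C%:E)%E).
    apply: ge0_le_integral => //.
    - exact: measurable_funTS.
    - by move=> t /=; rewrite in_itv/= => /andP[t0 _]; rewrite lee_fin phiC.
  rewrite integral_cst//= lebesgue_measure_itv/= lte_fin e0 sube0 -EFinM lee_fin.
  by rewrite /e mulrCA -[leRHS]mulr1 ler_pM2l// ler_pdivrMr ?mul1r ?lerDl// ltr_wpDl.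
apply: (@le_trans _ _ (\int[mu]_(t in `[e, +oo[) (A * OU_kernel t)%:E))%E.
  apply: ge0_le_integral => //.
  - exact: measurable_funTS.
  - exact/measurable_EFinP/measurable_funM.
  - by move=> t /=; rewrite in_itv/= andbT => et; rewrite lee_fin phiA// (lt_le_trans e0).
under eq_integral do rewrite EFinM.
rewrite ge0_integralZl//.
- rewrite EFinM; apply: lee_wpmul2l; [by rewrite lee_fin|exact: integral_OU_kernel_le].
- exact/measurable_EFinP.
- by move=> t _; rewrite lee_fin.
Qed.

End time_integral.

(** * The semigroup as a standard Gaussian integral *)

Section OU.
Context {R : realType} {m : nat}.
Variable lam : R.
Hypothesis lam0 : 0 < lam.
Local Notation gamma := (std_gaussian m).

Definition OU_std (t : R) : R :=
  sqrtr (1 - expR (- (2 * lam * t))) * sqrtr (2 * lam)^-1.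

Definition OU_point (t : R) (x y : 'rV[R]_m) : 'rV[R]_m :=
  expR (- (lam * t)) *: x + OU_std t *: y.

Lemma measurable_OU_std : measurable_fun setT OU_std.
Proof.
apply: continuous_measurable_fun => t.
apply: cvgM; last exact: cvg_cst.
apply: (@continuous_comp _ _ _ (fun s => 1 - expR (- (2 * lam * s))) sqrtr).
  apply: cvgB; [exact: cvg_cst|exact: continuous_expRN].
exact: sqrt_continuous.
Qed.

Lemma measurable_OU_point (x : 'rV[R]_m) :
  measurable_fun setT (fun ty : measurableTypeR R * 'rV[R]_m => OU_point ty.1 x ty.2).
Proof.
apply: measurable_fun_coordP => i; rewrite /OU_point.
rewrite (_ : (fun _ => _) = fun ty : measurableTypeR R * 'rV[R]_m =>
  expR (- (lam * ty.1)) * x 0 i + OU_std ty.1 * ty.2 0 i); last first.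
  by apply/funext => ty; rewrite !mxE.
have mE : measurable_fun setT (fun t : R => expR (- (lam * t))).
  apply: continuous_measurable_fun; exact: continuous_expRN.
apply: measurable_funD; apply: measurable_funM => //.
- exact: (measurableT_comp mE measurable_fst).
- exact: (measurableT_comp measurable_OU_std measurable_fst).
- exact: (measurableT_comp (measurable_coord i) measurable_snd).
Qed.

Lemma measurable_OU_point_r (t : R) (x : 'rV[R]_m) : measurable_fun setT (OU_point t x).
Proof. exact: (measurableT_comp (measurable_OU_point x) (measurable_pair1 _)). Qed.

Variable g : 'rV[R]_m -> R.
Variable C : R.
Hypothesis mg : measurable_fun setT g.
Hypothesis gC : forall y, `|g y| <= C.

Lemma integrable_OU_point t x : gamma.-integrable setT (EFin \o (fun y => g (OU_point t x y))).
Proof.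
apply: (@bounded_integrable_prob _ _ _ _ _ C) => //.
exact: (measurableT_comp mg (measurable_OU_point_r t x)).
Qed.

(** The square root of a scalar covariance is scalar, so it merges with the time factor into the
    single coefficient [OU_std t]. *)
Lemma OU_semigroupE t x : OU_semigroup lam t g x = \int[gamma]_y g (OU_point t x y).
Proof.
have q0 : 0 <= (2 * lam)^-1 by rewrite invr_ge0 mulr_ge0// ltW.
rewrite /OU_semigroup /Rintegral; congr fine.
have E (y : 'rV[R]_m) : expR (- (lam * t)) *: x +
   sqrtr (1 - expR (- (2 * lam * t))) *: rmul (psd_sqrt ((2 * lam)^-1)%:M) y = OU_point t x y.
  by rewrite /rmul psd_sqrt_scalar// mul_mx_scalar scalerA.
rewrite /gaussian integral_distribution.
- by apply: eq_integral => y _; rewrite /= E.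
- apply/measurable_EFinP; apply: (measurableT_comp mg).
  apply: measurable_fun_coordP => i.
  under eq_fun do rewrite mxE [X in _ + X]mxE.
  apply: measurable_funD => //; apply: measurable_funM => //; exact: measurable_coord.
- apply: eq_integrable (integrable_OU_point t x) => // y _ /=.
  by rewrite E.
Qed.

Lemma measurable_OU_semigroup x : measurable_fun setT (fun t => OU_semigroup lam t g x).
Proof.
under eq_fun do rewrite OU_semigroupE.
apply: measurableT_comp => //.
pose G (ty : measurableTypeR R * 'rV[R]_m) := (g (OU_point ty.1 x ty.2))%:E.
(* The normal law on the time axis is an auxiliary choice: as a probability it makes the bounded [G]
   integrable on the product, and Fubini then yields measurability in [t]. *)
have iG : (normal_prob 0 1 \x gamma)%E.-integrable setT G.
  apply: (@bounded_integrable_prob _ _ _ (normal_prob 0 1 \x gamma)%E _ C) => //.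
  exact: (measurableT_comp mg (measurable_OU_point x)).
exact: (measurable_fubini_F iG).
Qed.

Lemma OU_semigroup_le t x : `|OU_semigroup lam t g x| <= C.
Proof.
rewrite OU_semigroupE; apply: le_normr_Rintegral_prob => //.
exact: integrable_OU_point.
Qed.

End OU.

Section rdot_bound.
Context {R : realType}.

(** The first absolute moment is controlled by the second, which is at most [|h|^2]. The weight
    [n = |h|] makes the two halves of the quadratic bound add up to exactly [n]; since it is divided
    by, [h = 0] is treated apart. *)
Lemma integral_norm_rdot_le m (h : 'rV[R]_m) :
  \int[std_gaussian m]_y `|rdot h y| <= enorm h.
Proof.
have [h0|n0] := eqVneq (enorm h) 0.
  rewrite h0 (rdot0_enorm h0) /Rintegral.
  rewrite integral0_eq// => y _; rewrite /rdot big1 ?normr0// => i _.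
  by rewrite mxE mul0r.
have {}n0 : 0 < enorm h by rewrite lt_neqAle eq_sym n0 sqrtr_ge0.
have [i2 _ h2] := std_gaussian_moments h.
have n2 : enorm h * enorm h = rdot h h by rewrite -expr2 sqr_sqrtr// rdot_ge0.
set n := enorm h in n0 n2 *.
(* AM-GM: [|r| <= (r^2 / n + n) / 2] *)
apply: (@le_trans _ _ (\int[std_gaussian m]_y ((2 * n)^-1 * (rdot h y * rdot h y) + n / 2))).
  apply: le_Rintegral => //.
  - exact: integrable_norm (integrable_std_gaussian_rdot h).
  - apply: (@integrableD _ _ _ _ _ measurableT
      (EFin \o (fun y => (2 * n)^-1 * (rdot h y * rdot h y)))
      (EFin \o cst (n / 2))).
      exact: (@integrableZl _ _ _ _ _ measurableT (2 * n)^-1 _ i2).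
    exact: finite_measure_integrable_cst.
  - move=> y _; rewrite -subr_ge0.
    rewrite (_ : rdot h y * rdot h y = `|rdot h y| ^+ 2); last first.
      by rewrite real_normK ?num_real// expr2.
    have -> : (2 * n)^-1 * `|rdot h y| ^+ 2 + n / 2 - `|rdot h y| =
        (2 * n)^-1 * (`|rdot h y| - n) ^+ 2 by field; rewrite gt_eqF.
    by rewrite mulr_ge0 ?sqr_ge0// invr_ge0 mulr_ge0// ltW.
rewrite RintegralD//; last 2 first.
- exact: (@integrableZl _ _ _ _ _ measurableT (2 * n)^-1 _ i2).
- exact: finite_measure_integrable_cst.
rewrite (@RintegralZl _ _ _ _ setT (fun y => rdot h y * rdot h y))// /Rintegral integral_prob_cst.
have X : fine (\int[std_gaussian m]_y (rdot h y * rdot h y)%:E)%E <= n * n.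
  by rewrite -lee_fin fineK ?n2//; apply: integrable_fin_num.
rewrite [leRHS](_ : n = (2 * n)^-1 * (n * n) + n / 2); last first.
  by field; rewrite gt_eqF.
by rewrite lerD2r ler_wpM2l// invr_ge0 mulr_ge0// ltW.
Qed.

End rdot_bound.

(** * Differentiability from a quadratic remainder *)

Section differentiability.
Context {R : realType}.

(** The remainder is at most [e |h|] as soon as [|h| <= e / (|K| + 1)], so it is [o(h)], and
    uniqueness of the differential identifies it with [rdot D]. *)
Lemma quadratic_remainder_differentiable m (u : 'rV[R]_m -> R) (x D : 'rV[R]_m) (K : R) :
  (forall h, `|u (x + h) - u x - rdot D h| <= K * `|h| ^+ 2) ->
  differentiable u x /\ forall v, 'D_v u x = rdot D v.
Proof.
move=> uK.
have cD : continuous (rdot D).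
  move=> y; rewrite /continuous_at /rdot.
  apply: (@cvg_big _ _ _ _ _ add_continuous _ (nbhs y)) => i _.
  apply: cvgM; [exact: cvg_cst|exact: coord_continuous].
have uo : u \o shift x = cst (u x) + (rdot D : 'rV[R]_m -> R) +o_ (0 : 'rV[R]_m) id.
  apply/eqaddoP => e e0 /=; near=> h.
  rewrite /= !fctE /= opprD addrA [h + x]addrC (le_trans (uK h))//.
  rewrite expr2 mulrA ler_wpM2r//.
  rewrite (@le_trans _ _ ((`|K| + 1) * `|h|))//.
    by rewrite ler_wpM2r// (le_trans (ler_norm K))// lerDl.
  rewrite -ler_pdivlMl ?ltr_wpDl//.
  near: h; apply: (@pseudometric_normed_Zmodule.nbhs0_le R 'rV[R]_m).
  by rewrite mulr_gt0// invr_gt0 ltr_wpDl.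
have dE := diff_unique cD uo.
have du : differentiable u x.
  by apply/diff_locallyP; rewrite dE.
by split => // v; rewrite deriveE// dE.
Unshelve. all: by end_near. Qed.

End differentiability.

(** * The gradient of the resolvent *)

Section resolvent.
Context {R : realType} {m : nat}.
Variable lam : R.
Hypothesis lam0 : 0 < lam.
Local Notation gamma := (std_gaussian m).
Local Notation mu := (@lebesgue_measure R).
Variables (f : 'rV[R]_m -> R) (df : 'I_m -> 'rV[R]_m -> R)
  (ddf : 'I_m -> 'I_m -> 'rV[R]_m -> R) (C : R).
Hypothesis cf : continuous f.
Hypothesis cdf : forall i, continuous (df i).
Hypothesis fdf : forall i y, is_derive y (delta_mx 0 i) f (df i y).
Hypothesis dfddf : forall i j y, is_derive y (delta_mx 0 j) (df i) (ddf i j y).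
Hypothesis fC : forall y, `|f y| <= C.
Hypothesis dfC : forall i y, `|df i y| <= C.
Hypothesis ddfC : forall i j y, `|ddf i j y| <= C.

Let mf := continuous_measurable_rV cf.
Let mdf i := continuous_measurable_rV (@cdf i).
Local Notation S t g := (OU_semigroup lam t g).

(** This is [<D S_t f(x), h>], written through the commutation [D S_t f = e^(- lam t) S_t (D f)];
    the semigroup itself is never differentiated. *)
Definition OU_drift (h x : 'rV[R]_m) (t : R) : R :=
  expR (- (lam * t)) * \sum_i h 0 i * S t (df i) x.

Lemma OU_driftE h x t :
  OU_drift h x t = \sum_i h 0 i * (expR (- (lam * t)) * S t (df i) x).
Proof. by rewrite /OU_drift mulr_sumr; apply: eq_bigr => i _; rewrite mulrCA. Qed.

Lemma expRN_le1 (t : R) : 0 <= t -> expR (- (lam * t)) <= 1.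
Proof. by move=> t0; rewrite -[leRHS]expR0 ler_expR oppr_le0 mulr_ge0// ltW. Qed.

Lemma sum_OU_semigroupE (h x : 'rV[R]_m) t :
  gamma.-integrable setT (EFin \o (fun y => \sum_i h 0 i * df i (OU_point lam t x y))) /\
  \int[gamma]_y (\sum_i h 0 i * df i (OU_point lam t x y)) = \sum_i h 0 i * S t (df i) x.
Proof.
have [i1 i2] := @Rintegral_sumZ R _ _ gamma setT _ (fun i => h 0 i)
  (fun i y => df i (OU_point lam t x y)) measurableT
  (fun i => integrable_OU_point lam (mdf i) (dfC i) t x).
split => //; rewrite i2; apply: eq_bigr => i _.
by rewrite (OU_semigroupE lam0 (mdf i) (dfC i)).
Qed.

(* Integration by parts moves the gradient onto the Gaussian weight, and
   [E |<h, y>| <= |h|]. *)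
Lemma OU_drift_le (M : R) (h x : 'rV[R]_m) t : (forall y, `|f y| <= M) -> 0 < t ->
  `|OU_drift h x t| <= sqrtr (2 * lam) * M * enorm h * OU_kernel lam t.
Proof.
move=> fM t0; set s := OU_std lam t.
have s0 : 0 < s.
  rewrite mulr_gt0// sqrtr_gt0.
    by rewrite subr_gt0 expRN_lt1// mulr_gt0.
  by rewrite invr_gt0 mulr_gt0.
have M0 : 0 <= M by rewrite (le_trans _ (fM 0)).
have mfp : measurable_fun setT (f \o OU_point lam t x).
  exact: (measurableT_comp mf (measurable_OU_point_r lam t x)).
have stein i : S t (df i) x = s^-1 * \int[gamma]_y (f (OU_point lam t x y) * y 0 i).
  apply: (mulfI (lt0r_neq0 s0)); rewrite mulrA divff ?gt_eqF// mul1r.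
  rewrite (OU_semigroupE lam0 (mdf i) (dfC i)).
  rewrite -RintegralZl//; last exact: (integrable_OU_point lam (mdf i) (dfC i) t x).
  rewrite /Rintegral; congr fine.
  (* Integration by parts asks for one bound on both the function and its derivative, hence the
     maximum. It does not appear in the resulting identity, so [C] is absent from the estimate. *)
  apply: (@std_gaussian_stein _ _ i (f \o OU_point lam t x)
    (fun y => s * df i (OU_point lam t x y)) (Num.max M (s * C))) => //.
  - apply: measurable_funM => //.
    exact: (measurableT_comp (mdf i) (measurable_OU_point_r lam t x)).
  - by move=> y; rewrite le_max fM.
  - by move=> y; rewrite le_max normrM gtr0_norm// ler_pM2l// dfC orbT.
  - move=> y; apply: is_derive_congr (is_derive_scale s (fdf i (OU_point lam t x y))) => a.
    rewrite /OU_point /= scalerDr scalerA -/s scalerA.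
    by rewrite addrCA (mulrC s).
  - move=> y a.
    have ca : {for a, continuous (fun b : R => OU_point lam t x (b *: delta_mx 0 i + y))}.
      apply: cvgD; first exact: cvg_cst.
      apply: cvgZ; first exact: cvg_cst.
      by apply: cvgD; [exact: scalel_continuous|exact: cvg_cst].
    apply: (@cvgM _ _ _ _ (cst s)); first exact: cvg_cst.
    exact: (continuous_comp ca (@cdf i _)).
have E : OU_drift h x t = expR (- (lam * t)) / s *
    \int[gamma]_y (f (OU_point lam t x y) * rdot h y).
  rewrite /OU_drift -mulrA; congr (_ * _).
  have ic i : gamma.-integrable setT (EFin \o (fun y => f (OU_point lam t x y) * y 0 i)).
    exact: (@bounded_mul_integrable _ _ _ gamma _ (fun y => y 0 i) M mfp
       (fun y => fM _) (integrable_std_gaussian_coord i)).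
  have [_ i2] := @Rintegral_sumZ R _ _ gamma setT _ (fun i => h 0 i) _ measurableT ic.
  under [in RHS]eq_Rintegral => y _.
    rewrite /rdot mulr_sumr; under eq_bigr do rewrite mulrCA; over.
  rewrite i2 mulr_sumr; apply: eq_bigr => i _.
  by rewrite stein mulrCA.
(* The factor [sqrt (2 lam)] comes from [1 / s = sqrt (2 lam) / sqrt (1 - e^(- 2 lam t))]. *)
have -> : sqrtr (2 * lam) * M * enorm h * OU_kernel lam t =
    expR (- (lam * t)) / s * (M * enorm h).
  rewrite /OU_kernel /s /OU_std sqrtrV ?mulr_ge0 ?ltW// invfM invrK; ring.
rewrite E normrM ger0_norm; last by rewrite mulr_ge0 ?expR_ge0// invr_ge0 ltW.
apply: ler_wpM2l; first by rewrite mulr_ge0 ?expR_ge0// invr_ge0 ltW.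
have iM := @bounded_mul_integrable _ _ _ gamma _ _ M mfp (fun y => fM _)
  (integrable_std_gaussian_rdot h).
apply: (le_trans (le_normr_Rintegral _ iM)) => //.
apply: (@le_trans _ _ (\int[gamma]_y (M * `|rdot h y|))).
  apply: le_Rintegral => //.
  - exact: integrable_norm iM.
  - exact: (@integrableZl _ _ _ _ _ measurableT M _
      (integrable_norm (integrable_std_gaussian_rdot h))).
  - by move=> y _; rewrite normrM ler_wpM2r//; exact: fM.
rewrite RintegralZl//; last exact: integrable_norm (integrable_std_gaussian_rdot h).
by rewrite ler_wpM2l// integral_norm_rdot_le.
Qed.

Definition OU_resolvent_grad (x : 'rV[R]_m) : 'rV[R]_m :=
  \row_i \int[mu]_(t in `[0, +oo[) (expR (- t) * (expR (- (lam * t)) * S t (df i) x)).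

Lemma measurable_OU_part i x :
  measurable_fun setT (fun t => expR (- (lam * t)) * S t (df i) x).
Proof.
apply: measurable_funM; last exact: (measurable_OU_semigroup lam0 (mdf i) (dfC i) x).
apply: continuous_measurable_fun; exact: continuous_expRN.
Qed.

Lemma OU_part_le i x t : 0 <= t -> `|expR (- (lam * t)) * S t (df i) x| <= C.
Proof.
move=> t0; rewrite normrM ger0_norm ?expR_ge0// -[leRHS]mul1r.
by rewrite ler_pM ?expR_ge0 ?expRN_le1// (OU_semigroup_le lam0 (mdf i) (dfC i)).
Qed.

Lemma rdot_OU_resolvent_grad h x :
  rdot (OU_resolvent_grad x) h = \int[mu]_(t in `[0, +oo[) (expR (- t) * OU_drift h x t).
Proof.
have [_ i2] := @Rintegral_sumZ R _ _ mu `[0, +oo[%classic _ (fun i => h 0 i) _ (measurable_itv _)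
  (fun i => integrable_expRNM (measurable_OU_part i x) (@OU_part_le i x)).
under [RHS]eq_Rintegral => t _.
  rewrite OU_driftE mulr_sumr; under eq_bigr do rewrite mulrCA; over.
by rewrite i2; apply: eq_bigr => i _; rewrite mxE mulrC.
Qed.

Lemma measurable_OU_drift h x : measurable_fun setT (OU_drift h x).
Proof.
rewrite (_ : OU_drift h x = fun t =>
    \sum_i h 0 i * (expR (- (lam * t)) * S t (df i) x)); last first.
  by apply/funext => t; exact: OU_driftE.
apply: measurable_sum => i; apply: measurable_funM => //; exact: measurable_OU_part.
Qed.

Lemma OU_drift_bound h x t : 0 <= t -> `|OU_drift h x t| <= \sum_i `|h 0 i| * C.
Proof.
move=> t0; rewrite OU_driftE (le_trans (ler_norm_sum _ _ _))// ler_sum// => i _.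
by rewrite normrM ler_wpM2l// OU_part_le.
Qed.

(** Moving [x] by [h] moves each [OU_point] by [e^(- lam t) h], which is no longer than [h]. The
    Taylor bound of [f] at that point is thus uniform in [t] and [y], and passes unchanged through
    two integrations of total mass 1. *)
Lemma OU_resolvent1_taylor x h :
  `|OU_resolvent1 lam f (x + h) - OU_resolvent1 lam f x - rdot (OU_resolvent_grad x) h|
  <= m%:R * (m%:R * C) * `|h| ^+ 2.
Proof.
have mS z := measurable_OU_semigroup lam0 mf fC z.
have Sle z t (_ : 0 <= t) := OU_semigroup_le lam0 mf fC t z.
have iS z := integrable_expRNM (mS z) (Sle z).
have iD := integrable_expRNM (measurable_OU_drift h x) (@OU_drift_bound h x).
rewrite rdot_OU_resolvent_grad /OU_resolvent1 -RintegralB// -RintegralB//; last first.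
  by apply: (@integrableB _ _ _ mu _ _ _ _ (iS _) (iS _)).
under eq_Rintegral do rewrite -!mulrBr.
apply: Rintegral_expRNM_le.
  by apply: measurable_funB; [exact: measurable_funB|exact: measurable_OU_drift].
move=> t t0.
rewrite !(OU_semigroupE lam0 mf fC) -RintegralB//; last 2 first.
- exact: (integrable_OU_point lam mf fC t _).
- exact: (integrable_OU_point lam mf fC t _).
set a := expR (- (lam * t)).
have [i1 i2] := sum_OU_semigroupE h x t.
have ia := @integrableZl _ _ _ _ _ measurableT a _ i1.
have iB := @integrableB _ _ _ _ _ measurableT _ _
  (integrable_OU_point lam mf fC t (x + h)) (integrable_OU_point lam mf fC t x).
rewrite /OU_drift -i2 -RintegralZl// -RintegralB//.
apply: le_normr_Rintegral_prob.
  exact: (@integrableB _ _ _ _ _ measurableT _ _ iB ia).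
move=> y; set p := OU_point lam t x y.
have -> : OU_point lam t (x + h) y = p + a *: h.
  by rewrite /p /OU_point scalerDr addrAC.
have -> : a * (\sum_i h 0 i * df i p) = rdot (\row_i df i p) (a *: h).
  by rewrite /rdot mulr_sumr; apply: eq_bigr => i _; rewrite !mxE; ring.
apply: (le_trans (C2_taylor fdf dfddf ddfC p _)).
apply: ler_wpM2l; first by rewrite !mulr_ge0// (le_trans _ (fC 0)).
rewrite normrZ exprMn ler_piMl ?sqr_ge0// exprn_ile1//.
by rewrite ger0_norm ?expR_ge0// expRN_le1.
Qed.

End resolvent.

(** * The gradient estimate *)

Theorem proposition2p1 (R : realType) (m : nat) (hm : (1 <= m)%N)
    (lam : R) (hlam : 0 < lam) (f : 'rV[R]_m -> R) (hf : C2b f) :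
  (forall x : 'rV[R]_m, differentiable (OU_resolvent1 lam f) x) /\
  (ereal_sup [set (sqrtr lam * enorm (grad (OU_resolvent1 lam f) x))%:E
               | x in [set: 'rV[R]_m]]
   <= (pi / sqrtr 2)%:E
      * ereal_sup [set `|f x|%:E | x in [set: 'rV[R]_m]])%E.
Proof.
case: hf => [[cf df cdf] C1df bf bdf bddf].
have [Cf Cf0 fCf] := bounded_fun_ub bf.
have [Cd Cd0 dCd] := @bounded_funs_ub R _ _ (fun i => partial i f) bdf.
have [Cdd Cdd0 ddCdd] := @bounded_funs_ub R _ _
  (fun ij : 'I_m * 'I_m => partial ij.2 (partial ij.1 f)) (fun ij => bddf ij.1 ij.2).
pose C := Cf + Cd + Cdd.
have fdf i y : is_derive y (delta_mx 0 i) f (partial i f y).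
  by split; [exact: df|].
have dfddf i j y : is_derive y (delta_mx 0 j) (partial i f) (partial j (partial i f) y).
  by have [_ d _] := C1df i; split; [exact: d|].
have fC y : `|f y| <= C.
  by rewrite (le_trans (fCf y))// /C -addrA lerDl addr_ge0.
have dfC i y : `|partial i f y| <= C.
  by rewrite (le_trans (dCd i y))// /C addrAC lerDr addr_ge0.
have ddfC i j y : `|partial j (partial i f) y| <= C.
  by rewrite (le_trans (ddCdd (i, j) y))// /C lerDr addr_ge0.
set u := OU_resolvent1 lam f.
have D x := quadratic_remainder_differentiable
  (OU_resolvent1_taylor hlam cf cdf fdf dfddf fC dfC ddfC x).
have gradE x : grad u x = OU_resolvent_grad lam (fun i => partial i f) x.
  by apply/rowP => i; rewrite mxE /partial (D x).2 rdotC rdot_delta.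
split=> [x|]; first exact: (D x).1.
set s := ereal_sup [set `|f x|%:E | x in _].
have fs y : (`|f y|%:E <= s)%E by apply: ereal_sup_ubound; exists y.
(* Finiteness turns the product of extended reals into a real one; the value at 0 excludes [-oo],
   and boundedness of [f] excludes [+oo]. *)
have sfin : s \is a fin_num.
  rewrite fin_numElt (lt_le_trans (ltNyr _) (fs 0))/=.
  apply: (@le_lt_trans _ _ C%:E); last exact: ltry.
  by apply: ge_ereal_sup => _ [y _ <-]; rewrite lee_fin.
rewrite -(fineK sfin); set M := fine s.
have fM y : `|f y| <= M by rewrite -lee_fin fineK.
have M0 : 0 <= M by rewrite (le_trans _ (fM 0)).
apply: ge_ereal_sup => _ [x _ <-]; rewrite -EFinM lee_fin gradE.
set G := OU_resolvent_grad _ _ x; set n := enorm G.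
have n2 : n * n = rdot G G by rewrite -expr2 sqr_sqrtr// rdot_ge0.
have n0 : 0 <= n by exact: sqrtr_ge0.
(* The drift is taken in the direction [h = G], so that the time integral is [<G, G> = n^2] while
   the bound is linear in [n]; dividing by [n] requires [n != 0]. *)
have H : n * n <= sqrtr (2 * lam) * M * n * (pi / (2 * lam)).
  rewrite n2 {1}/G (rdot_OU_resolvent_grad hlam cdf dfC) (le_trans (ler_norm _))//.
  apply: (Rintegral_OU_kernel_le hlam (measurable_OU_drift hlam cdf dfC G x)).
  - by rewrite !mulr_ge0// sqrtr_ge0.
  - exact: (OU_drift_bound hlam cdf dfC).
  - by move=> t t0; exact: (OU_drift_le hlam cf cdf fdf dfC G x fM t0).
have [n_eq0|n_neq0] := eqVneq n 0.
  by rewrite n_eq0 mulr0 mulr_ge0// divr_ge0 ?pi_ge0 ?sqrtr_ge0.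
have {}n0 : 0 < n by rewrite lt_neqAle eq_sym n_neq0.
have {}H : n <= sqrtr (2 * lam) * M * (pi / (2 * lam)).
  by rewrite -(ler_pM2r n0) mulrAC.
apply: (le_trans (ler_wpM2l (sqrtr_ge0 lam) H)).
have sl : sqrtr lam * sqrtr lam = lam by rewrite -expr2 sqr_sqrtr// ltW.
have s2 : sqrtr 2 * sqrtr 2 = 2 :> R by rewrite -expr2 sqr_sqrtr.
have s20 : sqrtr 2 != 0 :> R by rewrite gt_eqF// sqrtr_gt0.
have sl0 : sqrtr lam != 0 by rewrite gt_eqF// sqrtr_gt0.
(* The constants match exactly: [sqrt lam * sqrt (2 lam) * pi / (2 lam) = pi / sqrt 2]. Writing
   [lam] and [2] as squares of their roots makes this a field identity. *)
rewrite sqrtrM// -[X in _ / (_ * X)]sl -[X in _ / (X * _)]s2 le_eqVlt; apply/orP; left; apply/eqP.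
by field; rewrite s20 sl0.
Qed.
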